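(* There is a universal constant $C>0$ such that the following holds. Let $\tau>0$, $B>0$, let $P$ be a probability measure on a measurable space $(\Omega,\mathcal F)$, let $X:\Omega\to[-B,B]$ be measurable, and let $\mathcal R(X)=\sup\{\mathbb E_Q[X]:\ \mathrm{KL}(Q\Vert P)\le\tau\}$. For any $\delta\in(0,1)$ and $\epsilon\in(0,B]$, put $$h=\frac{B^2\exp(4\tau B/\epsilon)}{\epsilon^2},\qquad \Lambda=\log\Big(e+h+B+\frac1B+\frac1\epsilon+\tau+\frac1\tau+\frac1\delta\Big).$$ Then $|\mathcal R(X)-\mathcal R_n(X)|\le\epsilon$ with probability at least $1-\delta$ whenever $n\ge C\,\Lambda^{C}\,h$; that is, the number of samples needed is bounded by $\tilde{O}\big(B^2\exp(4\tau B/\epsilon)/\epsilon^2\big)$.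
   Context: The supremum is over probability measures $Q\ll P$ on $(\Omega,\mathcal F)$, and $\mathrm{KL}(Q\Vert P)=\int\log\frac{dQ}{dP}\,dQ$. (Equivalently, the divergence function is $\phi(x)=x\log x-x+1$ for $x\ge0$, $+\infty$ for $x<0$, and $\mathcal R(X)=\sup\{\int X\zeta\,dP:\zeta\ge0,\int\zeta\,dP=1,\int\phi(\zeta)\,dP\le\tau\}$.) $P_n$ is the empirical distribution of $n$ i.i.d. samples from $P$, and $\mathcal R_n(X)=\sup\{\mathbb E_Q[X]:Q\ll P_n,\ \mathrm{KL}(Q\Vert P_n)\le\tau\}$. *)

(* Defs.v *)
From HB Require Import structures.
From mathcomp Require Import all_boot all_order all_algebra.
From mathcomp Require Import all_classical all_reals all_analysis.

Set Implicit Arguments.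
Unset Strict Implicit.
Unset Printing Implicit Defensive.

Import Order.TTheory GRing.Theory Num.Theory.
Import numFieldNormedType.Exports.

Local Open Scope classical_set_scope.
Local Open Scope ring_scope.
Local Open Scope charge_scope.
Local Open Scope ereal_scope.

(* Meaningful for Q `<< P only.  The integral is always defined, with value in
   [0, +oo], when P is a probability: the negative part of lne (dQ/dP) is
   Q-integrable, and dQ/dP > 0 holds Q-almost everywhere (lne maps
   nonpositive values to -oo). *)
Definition KL d (T : measurableType d) (R : realType)
    (Q : probability T R) (P : {finite_measure set T -> \bar R}) : \bar R :=
  \int[Q]_w lne (('d (charge_of_finite_measure Q) '/d P) w).

Definition KL_ball d (T : measurableType d) (R : realType)
    (P : {finite_measure set T -> \bar R}) (tau : R) : set (probability T R) :=
  [set Q : probability T R | Q `<< P /\ KL Q P <= tau%:E].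

Definition worst_case d (T : measurableType d) (R : realType)
    (P : {finite_measure set T -> \bar R}) (tau : R) (X : T -> R) : \bar R :=
  ereal_sup [set 'E_Q[X] | Q in KL_ball P tau].

(* For n = 0 this is the zero measure; for n > 0 it is a probability measure. *)
Section empirical.
Context d (T : measurableType d) (R : realType) (n : nat) (x : 'I_n -> T).

Definition empirical (A : set T) : \bar R :=
  (n%:R^-1)%:E * \sum_(i < n) \d_(x i) A.

Let dirac_seq (k : nat) : {measure set T -> \bar R} :=
  if insub k is Some i then \d_(x i) else mzero.

Let empiricalE : empirical = mscale (n%:R^-1 : R)%:nng%R (msum dirac_seq n).
Proof.
apply/funext => A; rewrite /empirical /mscale /msum/=; congr (_ * _).
by apply: eq_bigr => i _; rewrite /dirac_seq valK.
Qed.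

Let empirical0 : empirical set0 = 0.
Proof. by rewrite empiricalE measure0. Qed.

Let empirical_ge0 A : 0 <= empirical A.
Proof. by rewrite empiricalE measure_ge0. Qed.

Let empirical_sigma_additive : semi_sigma_additive empirical.
Proof. by rewrite empiricalE; exact: measure_semi_sigma_additive. Qed.

HB.instance Definition _ := isMeasure.Build _ _ _ empirical
  empirical0 empirical_ge0 empirical_sigma_additive.

Let empirical_finite : fin_num_fun empirical.
Proof.
move=> A mA; rewrite /empirical fin_numM//.
by apply/sum_fin_numP => i _ _; rewrite fin_num_measure.
Qed.

HB.instance Definition _ := @Measure_isFinite.Build _ _ _ empirical
  empirical_finite.

End empirical.
Arguments empirical {d T} R {n} x.

(* The product rule for all index subsets follows by taking A i = setT. *)
Definition iid_sample d (T : measurableType d) d' (S : measurableType d')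
    (R : realType) (mu : probability S R) (P : probability T R)
    (n : nat) (x : 'I_n -> {mfun S >-> T}) : Prop :=
  (forall i (A : set T), measurable A -> mu (x i @^-1` A) = P A) /\
  (forall A : 'I_n -> set T, (forall i, measurable (A i)) ->
     mu (\bigcap_i (x i @^-1` A i)) = \prod_(i < n) mu (x i @^-1` A i)).

(* Main.v *)
Require Import Defs.
From HB Require Import structures.
From mathcomp Require Import all_boot all_order all_algebra.
From mathcomp Require Import all_classical all_reals all_analysis.
From mathcomp Require Import measurable_realfun.
From mathcomp Require Import ring lra.

(* By duality, R(X) is the infimum over l > 0 of l tau + G(l) with
   G(l) = l log E exp (X / l): the upper bound is Gibbs' inequality, and the
   exponential tilts of P, whose divergence is continuous in the tilting
   parameter, attain it. Since G is nonincreasing, restricting l to the grid of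
   multiples of eps / (2 tau) up to about 2 B / tau costs at most eps / 2, both
   for P and for the empirical measure. At each grid point, a Chernoff bound for
   exp (X / l) / E exp (X / l), whose range is at most exp (2 B / l) and hence
   at most exp (4 tau B / eps), shows that G is estimated within eps / 2, and a
   union bound over the O(B / eps) grid points concludes. *)

Import Order.TTheory GRing.Theory Num.Theory.
Import numFieldNormedType.Exports.

Set Implicit Arguments.
Unset Strict Implicit.
Unset Printing Implicit Defensive.

Local Open Scope classical_set_scope.
Local Open Scope ring_scope.

(** * Integrals and densities *)

(** That [h] contains only the first power of exp (4 tau B / eps) shapes the concentration step. The
    variable exp (X / l) / E exp (X / l) has mean 1 and a range as large as that exponential, so a
    bound by the range alone would cost its square. A Bernstein-type bound sees the second moment
    instead, and for a nonnegative variable of mean 1 this is at most the range. For large l the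
    tolerance eps / (2 l) on the logarithm shrinks, but the variance then decreases like (B / l)^2,
    so one exponent serves all multipliers. The dual infimum need not be attained: the divergence of
    the tilts can stay below tau when X has a large atom at its maximum. Hence lower bounds hold up
    to an arbitrary slack. Duality is proved for finite measures of mass 1, so that it covers both P
    and the empirical measures. It also yields measurability of the good event: the worst case is a
    supremum over an uncountable family, but the dual can be restricted to rational multipliers. *)

(** Comparing positive and negative parts separately avoids integrability, which is not known for
    the log density in Gibbs' inequality. *)
Lemma integral_le_pointwise d (T : measurableType d) (R : realType)
    (m : {measure set T -> \bar R}) (f g : T -> \bar R) :
  measurable_fun setT f -> measurable_fun setT g -> (forall x, f x <= g x)%E ->
  (\int[m]_x f x <= \int[m]_x g x)%E.
Proof.
move=> mf mg fg; rewrite [leLHS]integralE [leRHS]integralE; apply: leeB.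
  apply: ge0_le_integral => //; [exact: measurable_funepos..|].
  by move=> x /mem_set; apply: funepos_le => y _; exact: fg.
apply: ge0_le_integral => //; [exact: measurable_funeneg..|].
by move=> x /mem_set; apply: funeneg_le => y _; exact: fg.
Qed.

Lemma finite_measure_bounded_integrable d (T : measurableType d) (R : realType)
    (m : {finite_measure set T -> \bar R}) (f : T -> R) (c : R) :
  measurable_fun setT f -> (forall x, `|f x| <= c) ->
  m.-integrable setT (EFin \o f).
Proof.
move=> mf fc; apply: measurable_bounded_integrable => //.
  by rewrite ltey_eq fin_num_measure.
exists c; split=> [|M cM x _] /=; first exact: num_real.
  by rewrite (le_trans (fc x))// ltW.
Qed.

(** Nonnegativity takes the place of integrability: in Gibbs' inequality the function is shown
    integrable by means of the resulting value. *)
Lemma ge0_Radon_Nikodym_integral d (T : measurableType d) (R : realType)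
    (Q P : {finite_measure set T -> \bar R}) (f : T -> \bar R) :
  Q `<< P -> measurable_fun setT f -> (forall x, 0 <= f x)%E ->
  (\int[Q]_x f x =
   \int[P]_x (f x * Radon_Nikodym (charge_of_finite_measure Q) P x))%E.
Proof.
move=> QP mf f0.
rewrite -(Radon_Nikodym_SigmaFinite.change_of_variables QP f0 measurableT mf).
apply: ae_eq_integral => //.
- apply: emeasurable_funM => //.
  exact: measurable_int (Radon_Nikodym_SigmaFinite.f_integrable QP).
- apply: emeasurable_funM => //; exact: measurable_int
    (@Radon_Nikodym_integrable _ _ _ (charge_of_finite_measure Q) P QP).
- by apply: ae_eqe_mul2l; exact: ae_eq_Radon_Nikodym_SigmaFinite.
Qed.

Lemma lne_fin_num (R : realType) (z : \bar R) : z \is a fin_num ->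
  lne z = if fine z <= 0 then -oo%E else (ln (fine z))%:E.
Proof. by case: z. Qed.

(** The set where the density is nonpositive is [Q]-null, because the density has a nonpositive
    integral over it. The value [-oo] of [lne] there can thus be traded for the finite one of [ln],
    which makes the integrand real. *)
Lemma KL_ln_density d (T : measurableType d) (R : realType)
    (Q : probability T R) (P : {finite_measure set T -> \bar R}) : Q `<< P ->
  KL Q P = (\int[Q]_x (ln (fine
    (Radon_Nikodym (charge_of_finite_measure Q) P x)))%:E)%E.
Proof.
move=> QP; pose z := Radon_Nikodym (charge_of_finite_measure Q) P.
have zfin x : z x \is a fin_num by exact: Radon_Nikodym_fin_num.
have mz : measurable_fun setT z.
  exact: measurable_int
    (@Radon_Nikodym_integrable _ _ _ (charge_of_finite_measure Q) P QP).
have mfz : measurable_fun setT (fun x => fine (z x)).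
  by apply: measurableT_comp mz.
have mA : measurable [set x | (z x <= 0)%E].
  by rewrite -[X in measurable X]setTI; exact: emeasurable_fun_infty_c.
rewrite /KL -/z.
under eq_integral => x _ do rewrite -/(z x) lne_fin_num//.
apply: ae_eq_integral => //.
- apply: measurable_fun_ifT => //; first exact: measurable_fun_ler.
  by apply/measurable_EFinP; exact: measurableT_comp mfz.
- by apply/measurable_EFinP; exact: measurableT_comp mfz.
exists [set x | (z x <= 0)%E]; split => //.
- apply/eqP; rewrite eq_le measure_ge0 andbT.
  have /= -> := @Radon_Nikodym_integral _ _ _
    (charge_of_finite_measure Q) P _ QP mA.
  rewrite -[leRHS](@integral0 _ _ _ P [set x | (z x <= 0)%E]).
  apply: le_integral => [||//|x /[!inE]//]; [exact: mA| |exact: integrable0].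
  exact: integrableS measurableT mA (@subsetT _ _)
    (@Radon_Nikodym_integrable _ _ _ (charge_of_finite_measure Q) P QP).
- move=> x /=; apply: contra_notP => /negP; rewrite -ltNge => zx _.
  by move: zx; rewrite -(fineK (zfin x)) lte_fin /= leNgt => ->.
Qed.

Lemma density_finite_measure d (T : measurableType d) (R : realType)
    (P : {measure set T -> \bar R}) (p : T -> R) :
  P.-integrable setT (EFin \o p) -> (forall x, 0 <= p x) ->
  exists Q : {finite_measure set T -> \bar R},
    forall A, measurable A -> Q A = (\int[P]_(x in A) (p x)%:E)%E.
Proof.
move=> intp p0; pose nu (A : set T) := (\int[P]_(x in A) (p x)%:E)%E.
have nu0 : nu set0 = 0%E by exact: integral_set0.
have nu_ge0 A : (0 <= nu A)%E.
  by apply: integral_ge0 => x _; rewrite lee_fin.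
have nu_sa : semi_sigma_additive nu.
  apply: semi_sigma_additive_nng_induced; last by move=> x; rewrite lee_fin.
  exact: measurable_int intp.
have nu_fin : fin_num_fun nu.
  move=> A mA; apply: integrable_fin_num => //.
  exact: integrableS measurableT mA (@subsetT _ _) intp.
pose m : {measure set T -> \bar R} :=
  HB.pack nu (isMeasure.Build _ _ _ nu nu0 nu_ge0 nu_sa).
by exists (HB.pack (Measure.sort m)
  (@Measure_isFinite.Build _ _ _ m nu_fin) : {finite_measure set T -> \bar R}).
Qed.

Section density.
Context d (T : measurableType d) (R : realType).
Context (Q P : {finite_measure set T -> \bar R}) (p : T -> R).
Context (intp : P.-integrable setT (EFin \o p)).
Context (QE : forall A, measurable A -> Q A = (\int[P]_(x in A) (p x)%:E)%E).

Lemma density_dominates : Q `<< P.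
Proof.
apply/null_content_dominatesP => A mA PA0.
rewrite QE//; apply: null_set_integral => //.
by apply: measurable_funTS; exact: measurable_int intp.
Qed.

Lemma density_Radon_Nikodym : ae_eq P setT
  (Radon_Nikodym (charge_of_finite_measure Q) P) (EFin \o p).
Proof.
have QP : charge_of_finite_measure Q `<< P by exact: density_dominates.
apply: integral_ae_eq => //.
- exact: Radon_Nikodym_integrable.
- exact: measurable_int intp.
- by move=> A _ mA; rewrite -Radon_Nikodym_integral//; exact: QE.
Qed.

Lemma ge0_density_integral (f : T -> \bar R) : measurable_fun setT f ->
  (forall x, 0 <= f x)%E ->
  (\int[Q]_x f x = \int[P]_x (f x * (p x)%:E))%E.
Proof.
move=> mf f0; rewrite (ge0_Radon_Nikodym_integral density_dominates mf f0).
apply: ae_eq_integral => //.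
- apply: emeasurable_funM => //; exact: measurable_int
    (@Radon_Nikodym_integrable _ _ _ (charge_of_finite_measure Q) P
      density_dominates).
- by apply: emeasurable_funM => //; exact: measurable_int intp.
- by apply: ae_eqe_mul2l; exact: density_Radon_Nikodym.
Qed.

End density.

(** * Duality *)

Definition mgf d (T : measurableType d) (R : realType)
    (m : {measure set T -> \bar R}) (X : T -> R) (b : R) : R :=
  \int[m]_w expR (b * X w).

(* [l * tau + logmgf l] is the Lagrangian dual objective at multiplier [l]. *)
Definition logmgf d (T : measurableType d) (R : realType)
    (m : {measure set T -> \bar R}) (X : T -> R) (l : R) : R :=
  l * ln (mgf m X l^-1).

Section bounded_variable.
Context d (T : measurableType d) (R : realType).
Context (P : {finite_measure set T -> \bar R}) (P1 : P setT = 1%E).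
Context (X : T -> R) (B : R) (mX : measurable_fun setT X).
Context (XB : forall w, `|X w| <= B).

Let measurable_tilt b c : measurable_fun setT (fun w => expR (b * X w - c)).
Proof.
apply: measurableT_comp => //.
by apply: measurable_funB => //; exact: measurable_funM.
Qed.

Let bX_le b w : `|b * X w| <= `|b| * B.
Proof. by rewrite normrM ler_wpM2l. Qed.

Let tilt_bounded b c w : `|expR (b * X w - c)| <= expR (`|b| * B + `|c|).
Proof.
rewrite ger0_norm ?expR_ge0// ler_expR.
have := bX_le b w; have := ler_norm (b * X w); have := ler_norm (- c).
rewrite normrN; lra.
Qed.

Let integrable_tilt b c : P.-integrable setT (fun w => (expR (b * X w - c))%:E).
Proof. exact: finite_measure_bounded_integrable (tilt_bounded b c). Qed.

Lemma integrable_mgf b : P.-integrable setT (fun w => (expR (b * X w))%:E).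
Proof.
have := integrable_tilt b 0; apply: eq_integrable => // w _ /=.
by rewrite subr0.
Qed.

Lemma Rintegral_cst1 r : \int[P]_w (cst r w) = r.
Proof.
transitivity (r * fine (P setT)); first exact: Rintegral_cst.
by rewrite P1 mulr1.
Qed.

Lemma Rintegral_bound (f : T -> R) (a c : R) : measurable_fun setT f ->
  (forall w, a <= f w <= c) -> a <= \int[P]_w f w <= c.
Proof.
move=> mf fac.
have intf : P.-integrable setT (EFin \o f).
  apply: (@finite_measure_bounded_integrable _ _ _ _ _ (`|a| + `|c|)) => // w.
  rewrite ler_norml; move: (fac w) (ler_norm (- a)) (ler_norm c).
  rewrite normrN; have := normr_ge0 a; have := normr_ge0 c; lra.
have intc r : P.-integrable setT (EFin \o cst r).
  exact: finite_measure_integrable_cst.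
have E := Rintegral_cst1.
by apply/andP; split; [rewrite -[leLHS](E a)|rewrite -[leRHS](E c)];
  apply: le_Rintegral => // w _; have /andP[] := fac w.
Qed.

Lemma mgf_bound b : expR (- (`|b| * B)) <= mgf P X b <= expR (`|b| * B).
Proof.
apply: Rintegral_bound => [|w].
  by apply: measurableT_comp => //; exact: measurable_funM.
by rewrite !ler_expR -ler_norml.
Qed.

Lemma mgf_gt0 b : 0 < mgf P X b.
Proof. by have /andP[+ _] := mgf_bound b; apply: lt_le_trans; exact: expR_gt0. Qed.

Lemma logmgf_bound l : 0 < l -> - B <= logmgf P X l <= B.
Proof.
move=> l0; have /andP[h1 h2] := mgf_bound l^-1.
have E : `|l^-1| * B = l^-1 * B by rewrite ger0_norm// invr_ge0 ltW.
rewrite E in h1 h2; rewrite -[X in - X <= _](mulVKf (lt0r_neq0 l0)).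
rewrite -[X in _ <= _ <= X](mulVKf (lt0r_neq0 l0)) -mulrN /logmgf.
rewrite !ler_pM2l// -[X in X <= ln _]expRK -[X in _ <= _ <= X]expRK.
by rewrite !ler_ln ?posrE ?expR_gt0 ?mgf_gt0// h1.
Qed.

(** The exponential of [logmgf P X l] is the norm of exp X in L^(1/l), and these norms increase with
    the exponent. The power inequality is obtained by integrating Bernoulli's inequality [Bern],
    after subtracting [c] to normalize the mean to 1. *)
Lemma logmgf_nonincreasing a b : 0 < a -> a <= b ->
  logmgf P X b <= logmgf P X a.
Proof.
move=> a0 ab; have b0 := lt_le_trans a0 ab.
pose c := ln (mgf P X b^-1); pose p := b / a.
have p1 : 1 <= p by rewrite /p ler_pdivlMr// mul1r.
(* After division by [expR y], this is the sum of [expR ((p - 1) y) >= 1 + (p - 1) y] and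
   [(p - 1) expR (- y) >= (p - 1) (1 - y)]. *)
have Bern y : (1 - p) + p * expR y <= expR (p * y).
  rewrite -(ler_pM2r (expR_gt0 (- y))) mulrDl -mulrA expRxMexpNx_1 -expRD.
  have := expR_ge1Dx (p * y - y); have := expR_ge1Dx (- y).
  have : 0 <= p - 1 by lra.
  nra.
have intc r : P.-integrable setT (EFin \o cst r).
  exact: finite_measure_integrable_cst.
have E0 : \int[P]_w (expR (b^-1 * X w - c)) = 1.
  under eq_Rintegral do rewrite expRB.
  rewrite RintegralZr//; last exact: integrable_mgf.
  by rewrite -/(mgf _ _ _) /c lnK ?posrE ?mgf_gt0// divff// lt0r_neq0// mgf_gt0.
have intp : P.-integrable setT (EFin \o (fun w => p * expR (b^-1 * X w - c))).
  have := integrableZl measurableT p (integrable_tilt b^-1 c).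
  by apply: eq_integrable.
have h : 1 <= \int[P]_w expR (a^-1 * X w - p * c).
  have <- : \int[P]_w (cst (1 - p) w + p * expR (b^-1 * X w - c)) = 1.
    rewrite (RintegralD measurableT (intc _) intp).
    rewrite (RintegralZl _ measurableT (integrable_tilt _ _)) E0.
    by rewrite Rintegral_cst1 mulr1 subrK.
  apply: le_Rintegral => //.
  - exact: (integrableD measurableT (intc _) intp).
  - exact: integrable_tilt.
  - move=> w _; apply: le_trans (Bern _) _; rewrite ler_expR /p.
    rewrite le_eqVlt; apply/orP; left; apply/eqP.
    by field; rewrite !lt0r_neq0.
move: h; under eq_Rintegral do rewrite expRB.
rewrite RintegralZr//; last exact: integrable_mgf.
rewrite -/(mgf _ _ _) ler_pdivlMr ?expR_gt0// mul1r => h.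
rewrite /logmgf -/c (_ : b * c = a * (p * c)); last first.
  by rewrite /p; field; rewrite lt0r_neq0.
by rewrite ler_pM2l// -[leLHS]expRK ler_ln ?posrE ?expR_gt0 ?mgf_gt0.
Qed.

Lemma bounded_expectation_fin_num (Q : probability T R) :
  ('E_Q[X])%E \is a fin_num.
Proof.
rewrite unlock; apply: integrable_fin_num => //.
exact: finite_measure_bounded_integrable XB.
Qed.

(* Gibbs' inequality: integrate [ln z >= u + 1 - exp (u - ln z)] against [Q],
   where [z] is the density of [Q] and [exp u] the density of the exponential
   tilt of [P] by [X / l]. *)
Lemma Donsker_Varadhan (Q : probability T R) (l tau : R) : 0 < l ->
  Q `<< P -> (KL Q P <= tau%:E)%E ->
  ('E_Q[X] <= (l * tau + logmgf P X l)%:E)%E.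
Proof.
move=> l0 QP; rewrite KL_ln_density//.
set z := Radon_Nikodym _ P => KLtau.
have zfin x : z x \is a fin_num by exact: Radon_Nikodym_fin_num.
have mz : measurable_fun setT z.
  exact: measurable_int
    (@Radon_Nikodym_integrable _ _ _ (charge_of_finite_measure Q) P QP).
have mlnz : measurable_fun setT (fun x => ln (fine (z x))).
  by apply: measurableT_comp => //; exact: measurableT_comp mz.
pose c := ln (mgf P X l^-1).
pose u w := l^-1 * X w - c.
have mu_ : measurable_fun setT u.
  by apply: measurable_funB => //; exact: measurable_funM.
have ub w : `|u w| <= `|l^-1| * B + `|c|.
  by rewrite (le_trans (ler_normB _ _))// lerD2r.
pose r w := expR (u w - ln (fine (z w))).
have mr : measurable_fun setT r.
  by apply: measurableT_comp => //; exact: measurable_funB.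
have intu1 : Q.-integrable setT (fun w => (u w + 1)%:E).
  apply: (@finite_measure_bounded_integrable _ _ _ _ _ (`|l^-1| * B + `|c| + 1)).
    exact: measurable_funD.
  by move=> w; rewrite (le_trans (ler_normD _ _))// normr1 lerD2r.
(* [r] is [expR u] divided by the density, so passing to [P] cancels the density. Only an inequality
   results, since the tilt may charge the set where the density vanishes. *)
have r1 : (\int[Q]_w (r w)%:E <= 1)%E.
  rewrite (ge0_Radon_Nikodym_integral QP)//; last 2 first.
    exact/measurable_EFinP.
    by move=> x; rewrite lee_fin expR_ge0.
  have <- : (\int[P]_w (expR (u w))%:E = 1)%E.
    rewrite -[LHS]fineK ?integrable_fin_num//; last exact: integrable_tilt.
    rewrite -/(Rintegral _ _ _); congr (_%:E).
    under eq_Rintegral do rewrite expRB.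
    rewrite RintegralZr//; last exact: integrable_mgf.
    by rewrite -/(mgf _ _ _) /c lnK ?posrE ?mgf_gt0// divff// lt0r_neq0// mgf_gt0.
  apply: integral_le_pointwise.
  - by apply: emeasurable_funM => //; exact/measurable_EFinP.
  - by apply/measurable_EFinP; exact: measurableT_comp.
  - move=> w; rewrite -/z -(fineK (zfin w)) -EFinM lee_fin /r expRB.
    have [z0|z0] := leP (fine (z w)) 0.
      by rewrite (@le_trans _ _ 0)// ?expR_ge0// mulr_ge0_le0// divr_ge0// expR_ge0.
    by rewrite lnK ?posrE// divfK// gt_eqF.
have intr : Q.-integrable setT (fun w => (r w)%:E).
  apply/integrableP; split; first exact/measurable_EFinP.
  under eq_integral do rewrite gee0_abs ?lee_fin ?expR_ge0//.
  exact: le_lt_trans r1 (ltry _).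
have : (\int[Q]_w ((u w + 1)%:E - (r w)%:E) <= tau%:E)%E.
  apply: le_trans KLtau; apply: integral_le_pointwise.
  - by apply: emeasurable_funB; [exact: measurable_int intu1|exact/measurable_EFinP].
  - exact/measurable_EFinP.
  - move=> w; rewrite -EFinB lee_fin /r.
    have := expR_ge1Dx (u w - ln (fine (z w))); rewrite -/z; lra.
rewrite (integralB measurableT intu1 intr).
have intX : Q.-integrable setT (EFin \o X).
  exact: finite_measure_bounded_integrable XB.
have -> : (\int[Q]_w (u w + 1)%:E = (l^-1)%:E * 'E_Q[X] + (1 - c)%:E)%E.
  under eq_integral do rewrite -addrA EFinD EFinM.
  rewrite integralD//; last 2 first.
    by have := integrableZl measurableT l^-1 intX.
    exact: finite_measure_integrable_cst.
  rewrite integralZl// integral_cst// unlock.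
  congr (_ + _)%E; transitivity ((- c + 1)%:E * 1)%E.
    by congr (_ * _)%E; exact: probability_setT.
  by rewrite mule1 addrC.
rewrite -(fineK (bounded_expectation_fin_num Q)).
have rfin : (\int[Q]_w (r w)%:E \is a fin_num)%E by exact: integrable_fin_num.
rewrite -(fineK rfin) lee_fin in r1.
rewrite lee_fin => h; have {h} : l^-1 * fine ('E_Q[X])%E + (1 - c)
    - fine (\int[Q]_w (r w)%:E)%E <= tau.
  by rewrite -lee_fin EFinB (fineK rfin).
have : fine ('E_Q[X])%E = l * (l^-1 * fine ('E_Q[X])%E) by rewrite mulVKf// lt0r_neq0.
rewrite /logmgf -/c => E h; rewrite E -mulrDr ler_pM2l//; lra.
Qed.

(** * Exponential tilts *)

(** The derivative of [mgf P X] at [b]; its quotient by [mgf P X b] is the mean of [X] under the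
    tilt. *)
Definition moment b := \int[P]_w (X w * expR (b * X w)).

Let measurable_moment b : measurable_fun setT (fun w => X w * expR (b * X w)).
Proof.
apply: measurable_funM => //.
by apply: measurableT_comp => //; exact: measurable_funM.
Qed.

Let moment_bounded b w : `|X w * expR (b * X w)| <= B * expR (`|b| * B).
Proof.
rewrite normrM ler_pM// ger0_norm ?expR_ge0// ler_expR.
exact: le_trans (ler_norm _) (bX_le b w).
Qed.

Let integrable_moment b :
  P.-integrable setT (EFin \o (fun w => X w * expR (b * X w))).
Proof. exact: finite_measure_bounded_integrable (moment_bounded b). Qed.

(** Dominated convergence with a local envelope: on the unit interval around [b], monotonicity of
    [c] gives the constant bound [c (|b| + 1)]. *)
Let continuous_integral (f : R -> T -> R) (c : R -> R) :
  (forall b, measurable_fun setT (f b)) -> (forall w, continuous (f ^~ w)) ->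
  (forall b w, `|f b w| <= c `|b|) -> {homo c : x y / x <= y} ->
  continuous (fun b => \int[P]_w f b w).
Proof.
move=> mf cf fc ch b.
have bb b' : b' \in `]b - 1, b + 1[ -> `|b'| <= `|b| + 1.
  rewrite in_itv/= => /andP[h1 h2].
  have : `|b' - b| <= 1 by rewrite ler_norml; lra.
  have := ler_normD (b' - b) b; rewrite subrK; lra.
apply: (@continuity_under_integral _ _ _ P f setT measurableT (b - 1) (b + 1)
  _ _ (cst (c (`|b| + 1)))).
- by move=> b' _; exact: finite_measure_bounded_integrable (mf b') (fc b').
- by apply/nearW => w _ b' _; exact: cf.
- exact: finite_measure_integrable_cst.
- move=> b' hb; apply/nearW => w _; apply: le_trans (fc _ _) _.
  by apply: ch; exact: bb.
- by rewrite inE/= in_itv/=; apply/andP; split; lra.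
Qed.

(** The sign of [B] is read off at a point of [T]. The envelopes below are given without a point at
    hand, hence their use of the absolute value of [B]. *)
Let B_ge0 (w : T) : 0 <= B. Proof. exact: le_trans (normr_ge0 _) (XB w). Qed.

Let continuous_expM w : continuous (fun b : R => expR (b * X w)).
Proof.
move=> b; exact: continuous_comp (@mulrr_continuous R (X w) b)
  (@continuous_expR R _).
Qed.

Lemma continuous_mgf : continuous (mgf P X).
Proof.
apply: (@continuous_integral (fun b w => expR (b * X w))
  (fun a => expR (a * `|B|))) => [b|w|b w|a b ab].
- by apply: measurableT_comp => //; exact: measurable_funM.
- exact: continuous_expM.
- rewrite ger0_norm ?expR_ge0// ler_expR (ger0_norm (B_ge0 w)).
  exact: le_trans (ler_norm _) (bX_le b w).
- by rewrite ler_expR ler_wpM2r.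
Qed.

Lemma continuous_moment : continuous moment.
Proof.
apply: (@continuous_integral (fun b w => X w * expR (b * X w))
  (fun a => `|B| * expR (a * `|B|))) => [b|w b|b w|a b ab].
- exact: measurable_moment.
- exact: continuousM (@cst_continuous _ _ (X w) b) (@continuous_expM w b).
- by rewrite (ger0_norm (B_ge0 w)); exact: moment_bounded.
- by rewrite ler_wpM2l// ler_expR ler_wpM2r.
Qed.

(** With K = ln mgf, this is b K'(b) - K(b), the divergence from [P] of its tilt by [b X]. *)
Definition tilted_KL b := b * (moment b / mgf P X b) - ln (mgf P X b).

Lemma tilted_KL0 : tilted_KL 0 = 0.
Proof.
rewrite /tilted_KL mul0r sub0r /mgf.
under eq_Rintegral do rewrite mul0r expR0.
by rewrite Rintegral_cst1 ln1 oppr0.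
Qed.

Lemma continuous_tilted_KL : continuous tilted_KL.
Proof.
move=> b; have m0 := mgf_gt0 b.
have cV := continuousV (lt0r_neq0 m0) (@continuous_mgf b).
have c0 : {for b, continuous (@idfun R)} by move=> A.
have c1 := continuousM c0 (continuousM (@continuous_moment b) cV).
exact: continuousB c1 (continuous_comp (@continuous_mgf b) (continuous_ln m0)).
Qed.

(** Jensen's inequality for s ln s, through its tangent at [s = expR c], the mean of
    [expR (b * X w)]. *)
Lemma tilted_KL_ge0 b : 0 <= tilted_KL b.
Proof.
set c := ln (mgf P X b); have m0 := mgf_gt0 b.
have Ec : expR c = mgf P X b by rewrite lnK.
suff : c * mgf P X b <= b * moment b.
  rewrite /tilted_KL -/c subr_ge0 => h.
  by rewrite mulrA ler_pdivlMr.
have h y : (c + 1) * expR y - expR c <= y * expR y.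
  have := expR_ge1Dx (c - y); rewrite -(ler_pM2r (expR_gt0 y)) -expRD subrK; lra.
have i1 : P.-integrable setT (EFin \o (fun w => (c + 1) * expR (b * X w))).
  by have := integrableZl measurableT (c + 1) (integrable_mgf b); apply: eq_integrable.
have i2 : P.-integrable setT (EFin \o cst (expR c)).
  exact: finite_measure_integrable_cst.
have i3 : P.-integrable setT (EFin \o (fun w => b * (X w * expR (b * X w)))).
  by have := integrableZl measurableT b (integrable_moment b); apply: eq_integrable.
have : \int[P]_w ((c + 1) * expR (b * X w) - cst (expR c) w) <=
    \int[P]_w (b * (X w * expR (b * X w))).
  apply: le_Rintegral => //; first exact: (integrableB measurableT i1 i2).
  by move=> w _; rewrite mulrA; exact: h.
rewrite (RintegralB measurableT i1 i2) Rintegral_cst1.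
rewrite (RintegralZl _ measurableT (integrable_mgf b)).
rewrite (RintegralZl _ measurableT (integrable_moment b)).
rewrite -/(mgf _ _ _) -/(moment _) Ec; lra.
Qed.

(** The log density [b * X w - c] is affine in [X] and bounded, so the divergence reduces to the
    tilted mean of [X]. *)
Lemma exponential_tilt b : exists Q : probability T R,
  [/\ Q `<< P, KL Q P = (tilted_KL b)%:E &
      ('E_Q[X] = (moment b / mgf P X b)%:E)%E].
Proof.
pose c := ln (mgf P X b); have m0 := mgf_gt0 b.
have Ec : expR c = mgf P X b by rewrite lnK.
pose p w := expR (b * X w - c).
have intp : P.-integrable setT (EFin \o p) by exact: integrable_tilt.
have [nu nuE] := density_finite_measure intp (fun w => expR_ge0 _).
have Ip : \int[P]_w p w = 1.
  rewrite /p; under eq_Rintegral do rewrite expRB.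
  rewrite RintegralZr//; last exact: integrable_mgf.
  by rewrite -/(mgf _ _ _) Ec divff// lt0r_neq0.
have nu1 : nu setT = 1%E.
  by rewrite nuE// -Ip /Rintegral fineK// integrable_fin_num.
pose Q : probability T R := HB.pack (FiniteMeasure.sort nu)
  (@Measure_isProbability.Build _ _ _ nu nu1).
have QE A : measurable A -> Q A = (\int[P]_(x in A) (p x)%:E)%E by exact: nuE.
have QP := density_dominates intp QE.
have EX : ('E_Q[X] = (moment b / mgf P X b)%:E)%E.
  rewrite unlock.
  have intX : Q.-integrable setT (EFin \o X).
    exact: finite_measure_bounded_integrable XB.
  rewrite -(Radon_Nikodym_change_of_variables QP measurableT intX).
  rewrite -Ec -expRN -(RintegralZr _ measurableT (integrable_moment b)).
  rewrite /Rintegral fineK; last first.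
    apply: integrable_fin_num => //.
    by have := integrableZr measurableT (expR (- c)) (integrable_moment b).
  apply: ae_eq_integral => //.
  - by apply: emeasurable_funM; [exact/measurable_EFinP|exact: measurable_int
    (@Radon_Nikodym_integrable _ _ _ (charge_of_finite_measure Q) P QP)].
  - by apply/measurable_EFinP; exact: measurable_funM.
  - apply: (@ae_eq_trans _ _ _ _ _ _ _ (fun w => (X w)%:E * (p w)%:E)%E).
      by apply: ae_eqe_mul2l; exact: (density_Radon_Nikodym intp QE).
    by apply: aeW => w _; rewrite -EFinM /p expRD mulrA.
exists Q; split => //.
rewrite KL_ln_density//.
have intX : Q.-integrable setT (EFin \o X).
  exact: finite_measure_bounded_integrable XB.
transitivity (\int[Q]_w (b%:E * (X w)%:E + (- c)%:E))%E.
  apply: ae_eq_integral => //.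
  - apply/measurable_EFinP; apply: measurableT_comp => //.
    apply: measurableT_comp => //; exact: measurable_int
      (@Radon_Nikodym_integrable _ _ _ (charge_of_finite_measure Q) P QP).
  - apply: emeasurable_funD => //.
    by apply/measurable_EFinP; exact: measurable_funM.
  - apply: (null_dominates_ae_eq measurableT QP).
    have := density_Radon_Nikodym intp QE.
    by apply: filterS => w /(_ I) -> _ /=; rewrite /p expRK.
rewrite integralD//; last 2 first.
  exact: integrableZl.
  exact: finite_measure_integrable_cst.
rewrite integralZl// integral_cst//.
have -> : (\int[Q]_w (X w)%:E = (moment b / mgf P X b)%:E)%E by rewrite -EX unlock.
have -> : ((- c)%:E * Q setT = (- c)%:E)%E.
  by transitivity ((- c)%:E * 1)%E; [congr (_ * _)%E; exact: nu1|rewrite mule1].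
by [].
Qed.

(** As [b] grows, the divergence of the tilt tends to minus the logarithm of the mass that [P] puts
    on the essential supremum of [X]. The level [tau] may therefore never be reached; the second
    alternative accounts for this. *)
Lemma tilted_KL_eq_or_lt tau b0 : 0 < tau -> 0 < b0 ->
  (exists2 b, 0 < b & tilted_KL b = tau) \/ tilted_KL b0 <= tau.
Proof.
move=> tau0 b00; have [|tauK] := leP (tilted_KL b0) tau; [by right|left].
have cK : {within `[0, b0], continuous tilted_KL}.
  exact/continuous_subspaceT/continuous_tilted_KL.
have [|b] := @IVT _ tilted_KL 0 b0 tau (ltW b00) cK.
  by rewrite tilted_KL0 min_l ?max_r ?tilted_KL_ge0// (ltW tau0) ltW.
rewrite in_itv/= le_eqVlt => /andP[/predU1P[<-|b_gt0] _ Kb].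
  by move: tau0; rewrite -Kb tilted_KL0 ltxx.
by exists b.
Qed.

(** * Duality between the worst case and the multiplier problem *)

Section dual.
Context (tau : R) (tau0 : 0 < tau).

Lemma worst_case_le l : 0 < l ->
  (worst_case P tau X <= (l * tau + logmgf P X l)%:E)%E.
Proof.
move=> l0; apply: ge_ereal_sup => _ [Q [QP KLQ] <-].
exact: Donsker_Varadhan.
Qed.

Lemma le_worst_case eta : 0 < eta -> exists2 l, 0 < l &
  ((l * tau + logmgf P X l - eta)%:E <= worst_case P tau X)%E.
Proof.
move=> eta0; have b00 : 0 < tau / eta by rewrite divr_gt0.
(* The definition of [tilted_KL] solved for the tilted mean: with [l = b^-1], it is the dual
   objective with the divergence in place of [tau]. *)
have mK b : 0 < b ->
    moment b / mgf P X b = b^-1 * tilted_KL b + logmgf P X b^-1.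
  move=> b_gt0; rewrite /logmgf invrK -mulrDr subrK mulKf//.
  by rewrite lt0r_neq0.
have [[b b_gt0 Kb]|K0] := tilted_KL_eq_or_lt tau0 b00.
  exists b^-1; first by rewrite invr_gt0.
  have [Q [QP KLQ EQ]] := exponential_tilt b.
  apply: (@le_trans _ _ ('E_Q[X])%E); last first.
    by apply: ereal_sup_ubound; exists Q => //; split=> //; rewrite KLQ Kb.
  by rewrite EQ mK// Kb lee_fin; lra.
(* At this multiplier the term [l * tau] equals the slack [eta], so the tilt need only have a
   divergence between 0 and [tau]. *)
exists (tau / eta)^-1; first by rewrite invr_gt0.
have [Q [QP KLQ EQ]] := exponential_tilt (tau / eta).
apply: (@le_trans _ _ ('E_Q[X])%E); last first.
  by apply: ereal_sup_ubound; exists Q => //; split=> //; rewrite KLQ lee_fin.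
rewrite EQ mK// lee_fin.
have -> : (tau / eta)^-1 * tau = eta by field; rewrite !lt0r_neq0.
have : 0 <= (tau / eta)^-1 * tilted_KL (tau / eta).
  by rewrite mulr_ge0 ?tilted_KL_ge0// invr_ge0 ltW.
lra.
Qed.

Lemma worst_case_fin_num : worst_case P tau X \is a fin_num.
Proof.
have [l l0 h] := le_worst_case ltr01.
rewrite fin_numE; apply/andP; split.
  by apply: contraTN h => /eqP->; rewrite leeNy_eq.
by apply: contraTN (worst_case_le ltr01) => /eqP->; rewrite leye_eq.
Qed.

Let wc := fine (worst_case P tau X).

Lemma fine_worst_case_le l : 0 < l -> wc <= l * tau + logmgf P X l.
Proof. by move=> /worst_case_le; rewrite -(fineK worst_case_fin_num) lee_fin. Qed.

Lemma le_fine_worst_case eta : 0 < eta ->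
  exists2 l, 0 < l & l * tau + logmgf P X l <= wc + eta.
Proof.
move=> /le_worst_case[l l0]; rewrite -(fineK worst_case_fin_num) lee_fin => h.
by exists l => //; rewrite -lerBlDr.
Qed.

(** Since [logmgf] is nonincreasing, rounding a multiplier up to a rational costs only [tau] times
    the increment. Strict sublevel sets thereby become countable unions, as measurability
    requires. *)
Lemma fine_worst_case_lt a :
  wc < a <-> exists q : rat, 0 < ratr q :> R /\
    ratr q * tau + logmgf P X (ratr q) < a.
Proof.
split=> [wca|[q [q0]]]; last exact: le_lt_trans (fine_worst_case_le q0).
pose e := (a - wc) / 2; have e0 : 0 < e by rewrite divr_gt0// subr_gt0.
have [l l0 h] := le_fine_worst_case e0.
have /rat_in_itvoo[q] : l < l + e / tau by rewrite ltrDl divr_gt0.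
rewrite in_itv/= => /andP[lq ql].
exists q; split; first exact: lt_trans lq.
have := logmgf_nonincreasing l0 (ltW lq).
have : (ratr q - l) * tau < e by rewrite -ltr_pdivlMr// ltrBlDl.
rewrite mulrBl; have : e + e = a - wc by rewrite /e; field.
lra.
Qed.

(* A grid of step [eps / (2 tau)] loses at most [eps / 2] because [logmgf] is
   nonincreasing; beyond the last point the linear term alone exceeds [B]. *)
Lemma dual_grid (K : nat) eps l : 0 < eps -> 4 * B / eps <= K%:R ->
  (0 < K)%N -> 0 < l ->
  exists2 k, (k < K)%N &
    let lk := k.+1%:R * (eps / (2 * tau)) in
    lk * tau + logmgf P X lk <= l * tau + logmgf P X l + eps / 2.
Proof.
move=> eps0 KB K0 l0; pose l1 := eps / (2 * tau).
have l10 : 0 < l1 by rewrite divr_gt0// mulr_gt0.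
have l1tau : l1 * tau = eps / 2 by rewrite /l1; field; rewrite lt0r_neq0.
have [lK|Kl] := ltP l (K%:R * l1).
  have ll1 : 0 <= l / l1 by rewrite divr_ge0// ltW.
  pose k := Num.truncn (l / l1); have /andP[h1 h2] := truncn_itv ll1.
  rewrite ler_pdivlMr// in h1; rewrite ltr_pdivrMr// in h2.
  exists k; first by rewrite truncn_lt_nat// ltr_pdivrMr.
  cbv zeta; rewrite -/l1 -/k; have := logmgf_nonincreasing l0 (ltW h2).
  rewrite -/k -[in k.+1%:R * _ * _]natr1 !mulrDl mul1r l1tau.
  have : k%:R * l1 * tau <= l * tau by rewrite ler_pM2r.
  lra.
exists 0%N => //=; rewrite mul1r -/l1 l1tau.
have /andP[_ h1] := logmgf_bound l10; have /andP[h2 _] := logmgf_bound l0.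
have : K%:R * l1 * tau <= l * tau by rewrite ler_pM2r.
rewrite -mulrA l1tau.
have : 4 * B / eps * (eps / 2) <= K%:R * (eps / 2) by rewrite ler_pM2r// divr_gt0.
have -> : 4 * B / eps * (eps / 2) = 2 * B by field; rewrite lt0r_neq0.
lra.
Qed.

End dual.

End bounded_variable.

(** * Independence and concentration *)

Section iid.
Context d (T : measurableType d) d' (S : measurableType d') (R : realType).
Context (mu : probability S R) (P : probability T R).

(* Both sides, as functions of the indicator [f], are measures on [T]. *)
Lemma factor_integral (y : {mfun S >-> T}) (G : S -> R) (a : R) (f : T -> R) :
  mu.-integrable setT (EFin \o G) -> (forall s, 0 <= G s) -> 0 <= a ->
  (forall A, measurable A ->
    (\int[mu]_(s in y @^-1` A) (G s)%:E = a%:E * P A)%E) ->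
  measurable_fun setT f -> (forall w, 0 <= f w) ->
  (\int[mu]_s (f (y s) * G s)%:E = a%:E * \int[P]_w (f w)%:E)%E.
Proof.
move=> intG G0 a0 GA mf f0; have [nu nuE] := density_finite_measure intG G0.
have mfy : measurable_fun setT (fun s => (f (y s))%:E).
  by apply/measurable_EFinP; exact: measurableT_comp.
have mEf : measurable_fun setT (EFin \o f) by exact/measurable_EFinP.
transitivity (\int[nu]_s (f (y s))%:E)%E.
  rewrite (ge0_density_integral intG nuE)// => s.
  by rewrite lee_fin.
transitivity (\int[pushforward nu y]_w (f w)%:E)%E.
  by rewrite ge0_integral_pushforward// => w _; rewrite lee_fin.
rewrite -(ge0_integral_mscale P measurableT (NngNum a0) mEf); last first.
  by move=> w _ /=; rewrite lee_fin.
apply: eq_measure_integral => A mA _.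
transitivity (nu (y @^-1` A)); first by [].
rewrite nuE; first exact: GA.
by rewrite -[X in measurable X]setTI; exact: measurable_funPT.
Qed.

Context (n : nat) (x : 'I_n -> {mfun S >-> T}) (iidx : iid_sample mu P x).

Let Rintegral_indic (A : set T) : measurable A -> \int[P]_w \1_A w = fine (P A).
Proof. by move=> mA; rewrite /Rintegral integral_indic// setIT. Qed.

Let iid_prod_indic (A : 'I_n -> set T) : (forall i, measurable (A i)) ->
  (\int[mu]_s (\prod_i (\1_(A i) (x i s) : R))%:E =
   (\prod_i \int[P]_w (\1_(A i) w : R))%:E)%E.
Proof.
move=> mA.
have mxA i : measurable (x i @^-1` A i).
  by rewrite -[X in measurable X]setTI; exact: measurable_funPT.
transitivity (\int[mu]_s (\1_(\bigcap_i (x i @^-1` A i)) s)%:E)%E.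
  apply: eq_integral => s _; congr (_%:E).
  rewrite indicE; case: (boolP (s \in _)) => [/set_mem h|h].
    by rewrite big1// => i _; rewrite indicE mem_set//; exact: h.
  move: h; rewrite notin_setE => /existsNP[i /not_implyP[_ h]].
  by rewrite (bigD1 i)//= indicE memNset ?mul0r.
rewrite integral_indic//; last exact: fin_bigcap_measurable.
rewrite setIT; apply: (etrans (iidx.2 A mA)).
rewrite -prodEFin; apply: eq_bigr => i _.
rewrite Rintegral_indic// fineK ?fin_num_measure//; exact: iidx.1.
Qed.

(** Indicators are replaced by bounded functions one coordinate at a time, each replacement being an
    instance of [factor_integral]. The condition [1 <= c] lets indicators obey the same bound. *)
Lemma iid_prod (phi : 'I_n -> T -> R) (c : R) : 1 <= c ->
  (forall i, measurable_fun setT (phi i)) -> (forall i w, 0 <= phi i w <= c) ->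
  (\int[mu]_s (\prod_i phi i (x i s))%:E = (\prod_i \int[P]_w phi i w)%:E)%E.
Proof.
move=> c1 mphi phic.
(* Induction on [k]: the coordinates from [k] on are still indicators, the earlier ones are
   arbitrary. *)
suff H k : forall phi : 'I_n -> T -> R, (forall i, measurable_fun setT (phi i)) ->
    (forall i w, 0 <= phi i w <= c) ->
    (forall i : 'I_n, (k <= i)%N -> exists2 A, measurable A & phi i = \1_A) ->
    (\int[mu]_s (\prod_i phi i (x i s))%:E = (\prod_i \int[P]_w phi i w)%:E)%E.
  by apply: (H n) => // i; rewrite leqNgt ltn_ord.
elim: k => {mphi phic} [{}phi mphi phic /(_ _ isT) phiA|k IH {}phi mphi phic phiA].
  have /choice[A hA] : forall i, exists A, measurable A /\ phi i = \1_A.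
    by move=> i; have [A] := phiA i; exists A.
  have -> : phi = fun i => \1_(A i) by apply/funext => i; rewrite (hA i).2.
  by apply: iid_prod_indic => i; exact: (hA i).1.
have [nk|kn] := leqP n k.
  by apply: IH => // i ki; have := ltn_ord i; rewrite ltnNge (leq_trans nk).
pose i0 := Ordinal kn.
pose G s := \prod_(i | i != i0) phi i (x i s).
pose a := \prod_(i | i != i0) \int[P]_w phi i w.
have phi0 i w : 0 <= phi i w by have /andP[] := phic i w.
have mG : measurable_fun setT G.
  rewrite /G; under eq_fun do rewrite big_mkcond/=.
  apply: measurable_prod => i _; case: (i != i0); last exact: measurable_cst.
  exact: measurableT_comp.
have G0 s : 0 <= G s by apply: prodr_ge0 => i _.
have intG : mu.-integrable setT (EFin \o G).
  apply: (@finite_measure_bounded_integrable _ _ _ _ _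
    (\prod_(i < n | i != i0) c)) => // s.
  by rewrite ger0_norm//; apply: ler_prod => i _; exact: phic.
have a0 : 0 <= a by apply: prodr_ge0 => i _; apply: Rintegral_ge0.
under eq_integral do rewrite (bigD1 i0)//=.
rewrite (bigD1 i0)//= -/a.
rewrite (@factor_integral (x i0) G a (phi i0))//; last first.
  (* Restricting to the preimage of [A] replaces coordinate [i0] by [\1_A]; only the first [k]
     coordinates are then arbitrary, so [IH] applies. *)
  move=> A mA; pose psi i := if i == i0 then \1_A else phi i.
  transitivity (\int[mu]_s (\prod_i psi i (x i s))%:E)%E.
    rewrite integral_mkcond; apply: eq_integral => s _.
    rewrite (bigD1 i0)//= /psi eqxx patchE.
    under eq_bigr => i /negbTE ii0 do rewrite ii0.
    rewrite -/(G s) indicE (_ : (s \in x i0 @^-1` A) = (x i0 s \in A)).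
      by case: ifP => _; rewrite ?mul1r ?mul0r.
    by apply/idP/idP => /set_mem h; exact/mem_set.
  rewrite IH => [|i|i w|i ki].
  - rewrite (bigD1 i0)//= /psi eqxx.
    under eq_bigr => i /negbTE ii0 do rewrite ii0.
    by rewrite -/a Rintegral_indic// mulrC EFinM fineK// fin_num_measure.
  - by rewrite /psi; case: ifP => // _; exact: measurable_indic.
  - rewrite /psi; case: ifP => // _; rewrite indicE.
    by case: (_ \in _); rewrite ?lexx ?ler01/= ?(le_trans ler01).
  - rewrite /psi; case: ifPn => [_|ii0]; first by exists A.
    by apply: phiA; rewrite ltn_neqAle ki andbT eq_sym; exact: ii0.
rewrite [RHS]EFinM muleC; congr (_ * _)%E; rewrite /Rintegral fineK//.
apply: integrable_fin_num => //.
apply: (@finite_measure_bounded_integrable _ _ _ _ _ c) => // w.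
by rewrite ger0_norm//; have /andP[] := phic i0 w.
Qed.

End iid.

(** * A Bernstein-type bound *)

(** From [(1 - u) expR u <= 1], as the quadratic times [1 - u] is [1 + u^2 (1 - 2 u)], at least 1 in
    this range. *)
Lemma expR_le_quadratic (R : realType) (u : R) : u <= 1 / 2 ->
  expR u <= 1 + u + 2 * u ^+ 2.
Proof.
move=> u2; have u1 : 0 < 1 - u by lra.
rewrite -(ler_pM2r u1); apply: (@le_trans _ _ (expR u * expR (- u))).
  by rewrite ler_pM2l ?expR_gt0// expR_ge1Dx.
rewrite expRxMexpNx_1.
have -> : (1 + u + 2 * u ^+ 2) * (1 - u) = 1 + u ^+ 2 * (1 - 2 * u) by ring.
by rewrite lerDl mulr_ge0 ?sqr_ge0//; lra.
Qed.

(** The quadratic bound on the exponential, with mean 0 and second moment at most [V], gives E exp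
    (theta Y) <= exp (2 theta^2 V). The range [c] only limits [theta] and does not enter the
    exponent. *)
Lemma Chernoff_iid d (T : measurableType d) d' (S : measurableType d')
    (R : realType) (mu : probability S R) (P : probability T R) (n : nat)
    (x : 'I_n -> {mfun S >-> T}) (Y : T -> R) (c V t theta : R) :
  iid_sample mu P x -> measurable_fun setT Y -> (forall w, `|Y w| <= c) ->
  \int[P]_w Y w = 0 -> \int[P]_w (Y w ^+ 2) <= V ->
  0 <= theta -> theta * c <= 1 / 2 ->
  measurable [set s | (n%:R * t <= \sum_(i < n) Y (x i s))%R] /\
  (mu [set s | (n%:R * t <= \sum_(i < n) Y (x i s))%R] <=
    (expR (- (n%:R * (theta * t - 2 * theta ^+ 2 * V))))%:E)%E.
Proof.
move=> iidx mY Yc EY EV th0 thc; set A := [set s | _].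
have msum_ : measurable_fun setT (fun s => \sum_(i < n) Y (x i s)).
  by apply: measurable_sum => i; exact: measurableT_comp.
have mA : measurable A.
  rewrite -[A]setTI; apply: measurable_fun_le => //.
split=> //.
pose f w := expR (theta * Y w).
have mf : measurable_fun setT f.
  by apply: measurableT_comp => //; exact: measurable_funM.
have thY w : theta * Y w <= 1 / 2.
  by rewrite (le_trans _ thc)// ler_wpM2l// (le_trans (ler_norm _)).
have f1 w : 0 <= f w <= expR 1.
  by rewrite expR_ge0 ler_expR (le_trans (thY w)); lra.
have intY : P.-integrable setT (EFin \o Y).
  exact: finite_measure_bounded_integrable Yc.
have intY2 : P.-integrable setT (EFin \o (fun w => Y w ^+ 2)).
  apply: (@finite_measure_bounded_integrable _ _ _ _ _ (c ^+ 2)).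
    exact: measurable_funX.
  by move=> w; rewrite normrX lerXn2r ?nnegrE// (le_trans (normr_ge0 (Y w))).
have Ef : \int[P]_w f w <= expR (2 * theta ^+ 2 * V).
  have i1 : P.-integrable setT (EFin \o cst (1 : R)).
    exact: finite_measure_integrable_cst.
  have i2 : P.-integrable setT (EFin \o (fun w => theta * Y w)).
    by have := integrableZl measurableT theta intY; apply: eq_integrable.
  have i3 : P.-integrable setT (EFin \o (fun w => 2 * theta ^+ 2 * Y w ^+ 2)).
    by have := integrableZl measurableT (2 * theta ^+ 2) intY2; apply: eq_integrable.
  apply: (@le_trans _ _ (1 + 2 * theta ^+ 2 * V)); last exact: expR_ge1Dx.
  have P1 : P setT = 1%E by exact: probability_setT.
  apply: (@le_trans _ _ (\int[P]_w (cst 1 w + theta * Y w + 2 * theta ^+ 2 * Y w ^+ 2))).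
    apply: le_Rintegral => //.
    - apply: (@finite_measure_bounded_integrable _ _ _ _ _ (expR 1)) => // w.
      by rewrite ger0_norm; have /andP[] := f1 w.
    - exact: (integrableD measurableT (integrableD measurableT i1 i2) i3).
    - move=> w _; apply: le_trans (expR_le_quadratic (thY w)) _.
      by rewrite exprMn mulrA.
  rewrite (RintegralD measurableT (integrableD measurableT i1 i2) i3).
  rewrite (RintegralD measurableT i1 i2) (RintegralZl _ measurableT intY) EY.
  rewrite (RintegralZl _ measurableT intY2) (Rintegral_cst1 P1) mulr0 addr0.
  by rewrite lerD2l ler_wpM2l// mulr_ge0// sqr_ge0.
pose k := expR (- (theta * (n%:R * t))).
have E : (\int[mu]_s (\prod_(i < n) f (x i s))%:E = ((\int[P]_w f w) ^+ n)%:E)%E.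
  rewrite (iid_prod iidx (c := expR 1) (phi := fun=> f))//.
    by rewrite prodr_const card_ord.
  by rewrite -expR0 ler_expR.
have mpf : measurable_fun setT (fun s => (\prod_(i < n) f (x i s))%:E).
  by apply/measurable_EFinP; apply: measurable_prod => i _; exact: measurableT_comp.
have pf0 s : 0 <= \prod_(i < n) f (x i s).
  by apply: prodr_ge0 => i _; exact: expR_ge0.
(* Markov's inequality: this integrand is at least 1 on [A] and nonnegative elsewhere. *)
apply: (@le_trans _ _ (\int[mu]_s (k%:E * (\prod_(i < n) f (x i s))%:E))%E).
  apply: (@le_trans _ _ (\int[mu]_s (\1_A s)%:E)%E).
    by rewrite integral_indic// setIT.
  apply: ge0_le_integral => //.
  - by apply/measurable_EFinP; exact: measurable_indic.
  - by apply: emeasurable_funM.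
  - move=> s _; rewrite -EFinM lee_fin indicE.
    case: (boolP (s \in A)) => [/set_mem As|_]; last by rewrite mulr_ge0// expR_ge0.
    apply: (@le_trans _ _ (expR 0)); first by rewrite expR0.
    rewrite /k -expR_sum -expRD ler_expR addrC subr_ge0.
    by rewrite -mulr_sumr ler_wpM2l.
rewrite ge0_integralZl//; last 2 first.
- by move=> s _; rewrite lee_fin.
- by rewrite lee_fin expR_ge0.
rewrite E -EFinM lee_fin mulrBr opprB addrC expRD -/k.
rewrite /k (mulrCA n%:R) ler_pM2l ?expR_gt0//.
rewrite expRM_natl lerXn2r ?nnegrE ?expR_ge0//.
by apply: Rintegral_ge0 => w _; exact: expR_ge0.
Qed.

(** * Integrals against the empirical measure, and numerical bounds *)

Section empirical_integral.
Context d (T : measurableType d) (R : realType) (n : nat) (x : 'I_n -> T).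

Lemma ge0_integral_empirical (f : T -> R) : measurable_fun setT f ->
  (forall w, 0 <= f w) ->
  (\int[empirical R x]_w (f w)%:E = (n%:R^-1 * \sum_(i < n) f (x i))%:E)%E.
Proof.
move=> mf f0.
pose dirac_seq (k : nat) : {measure set T -> \bar R} :=
  if insub k is Some i then dirac (x i) else mzero.
have mEf : measurable_fun setT (EFin \o f) by exact/measurable_EFinP.
transitivity (\int[mscale (n%:R^-1 : R)%:nng%R (msum dirac_seq n)]_w (f w)%:E)%E.
  apply: eq_measure_integral => A mA _.
  rewrite /empirical /mscale /msum/=; congr (_ * _)%E.
  by apply: eq_bigr => i _; rewrite /dirac_seq valK.
rewrite ge0_integral_mscale//; last by move=> w _; rewrite lee_fin.
rewrite ge0_integral_measure_sum//; last by move=> w _; rewrite lee_fin.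
rewrite EFinM; congr (_ * _)%E; rewrite -sumEFin; apply: eq_bigr => i _.
by rewrite /dirac_seq valK integral_dirac// diracT mul1e.
Qed.

Lemma empirical_setT : (0 < n)%N -> empirical R x setT = 1%E.
Proof.
move=> n0; rewrite /empirical; under eq_bigr do rewrite diracT.
rewrite sumEFin sumr_const card_ord -EFinM mulVf//.
by rewrite pnatr_eq0 -lt0n.
Qed.

Lemma mgf_empirical (X : T -> R) (b : R) : measurable_fun setT X ->
  mgf (empirical R x) X b = n%:R^-1 * \sum_(i < n) expR (b * X (x i)).
Proof.
move=> mX; rewrite /mgf /Rintegral ge0_integral_empirical//.
by apply: measurableT_comp => //; exact: measurable_funM.
Qed.

End empirical_integral.

Lemma expR2_le16 (R : realType) : expR 2 <= 16 :> R.
Proof.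
have h : expR (1 / 2) <= 2 :> R.
  have e0 := expR_gt0 (1 / 2 : R).
  have : expR (1 / 2) * (1 + - (1 / 2)) <= expR (1 / 2) * expR (- (1 / 2)) :> R.
    by rewrite ler_pM2l// expR_ge1Dx.
  rewrite expRxMexpNx_1; lra.
have -> : expR 2 = expR (1 / 2) ^+ 4 :> R.
  by rewrite -expRM_natl; congr expR; field.
have -> : 16 = 2 ^+ 4 :> R by rewrite -natrX.
by rewrite lerXn2r ?nnegrE// expR_ge0.
Qed.

(** [expR z - 1 <= z expR z] because [expR z (1 - z) <= 1]; the 16 is the bound on [expR 2]. *)
Lemma expR_sub1_le (R : realType) (z : R) : 0 <= z -> z <= 2 -> expR z - 1 <= 16 * z.
Proof.
move=> z0 z2; have h : expR z <= 16.
  by apply: le_trans (expR2_le16 R); rewrite ler_expR.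
have : expR z * (1 + - z) <= expR z * expR (- z).
  by rewrite ler_pM2l ?expR_gt0// expR_ge1Dx.
have : z * expR z <= z * 16 by rewrite ler_wpM2l.
rewrite expRxMexpNx_1; lra.
Qed.

(** * Deviation of the empirical dual objective *)

Section deviation.
Context d (T : measurableType d) d' (S : measurableType d') (R : realType).
Context (mu : probability S R) (P : probability T R).
Context (n : nat) (x : 'I_n -> {mfun S >-> T}) (iidx : iid_sample mu P x).
Context (n0 : (0 < n)%N).
Context (X : T -> R) (mX : measurable_fun setT X).
Context (B eps tau : R) (XB : forall w, `|X w| <= B).
Context (eps0 : 0 < eps) (epsB : eps <= B) (tau0 : 0 < tau).

Let h := B ^+ 2 * expR (4 * tau * B / eps) / eps ^+ 2.
Let P1 : P setT = 1%E. Proof. exact: probability_setT. Qed.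
Let B0 : 0 < B. Proof. exact: lt_le_trans epsB. Qed.
Let emp s := empirical R (fun i => x i s).

Section fixed_multiplier.
Context (l : R) (l0 : eps / (2 * tau) <= l).

Let l_gt0 : 0 < l.
Proof. by apply: lt_le_trans l0; rewrite divr_gt0// mulr_gt0. Qed.

Let M := mgf P X l^-1.
Let M0 : 0 < M. Proof. by rewrite /M (mgf_gt0 P1 mX XB). Qed.

(** The empirical mean of [r] is the ratio of the empirical [mgf] to the true one. Its logarithm
    must stay within [eta], since [l * eta = eps / 2]. *)
Let r w := expR (l^-1 * X w) / M.
Let c := expR (2 * B / l) - 1.
Let eta := eps / (2 * l).
(** The cap at 1 and the half ensure [(1 - t) (1 + eta) >= 1], so a ratio within [t] of 1 has its
    logarithm within [eta] of 0. *)
Let t := Num.min eta 1 / 2.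
(** Proportional to [t ^+ 2], which makes the exponent [n t^2 / (8 V)] the same for every [l]. The
    factor 128 is 4 * 32: for [B <= l], [t = eps / (4 l)] and [c <= 32 (B / l)]. *)
Let V := (128 * t) ^+ 2 * h.

Let h0 : 0 < h.
Proof. by rewrite /h divr_gt0 ?exprn_gt0// mulr_gt0 ?exprn_gt0 ?expR_gt0. Qed.

Let eta0 : 0 < eta. Proof. by rewrite divr_gt0// mulr_gt0. Qed.

Let t0 : 0 < t. Proof. by rewrite divr_gt0// lt_min eta0 ltr01. Qed.

Let V0 : 0 < V. Proof. by apply: mulr_gt0 => //; rewrite exprn_gt0// mulr_gt0. Qed.

Let c0 : 0 <= c.
Proof. by rewrite subr_ge0 -expR0 ler_expR divr_ge0// ?mulr_ge0// ltW. Qed.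

Let measurable_r : measurable_fun setT r.
Proof.
apply: measurable_funM => //; apply: measurableT_comp => //.
exact: measurable_funM.
Qed.

Let r_bound w : 0 <= r w <= 1 + c.
Proof.
rewrite divr_ge0 ?expR_ge0 ?(ltW M0)//= /c addrC subrK ler_pdivrMr//.
have lV0 : 0 <= l^-1 by rewrite invr_ge0 ltW.
have /andP[+ _] := mgf_bound P1 mX XB l^-1; rewrite (ger0_norm lV0) -/M => hM.
apply: le_trans (ler_wpM2l (expR_ge0 _) hM).
rewrite -expRD ler_expR.
have : l^-1 * X w <= l^-1 * B by rewrite ler_wpM2l// (le_trans (ler_norm _)).
have -> : 2 * B / l = 2 * (l^-1 * B) by field; rewrite lt0r_neq0.
lra.
Qed.

(** With [z = 2 B / l], the lower deviation is controlled by the upper one: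
    [1 - expR (- z) <= z <= expR z - 1]. *)
Let r_dev w : `|r w - 1| <= c.
Proof.
have /andP[_ r1] := r_bound w; rewrite ler_norml lerBlDl r1 andbT.
rewrite -subr_ge0 opprK addrC.
have lV0 : 0 <= l^-1 by rewrite invr_ge0 ltW.
have h1 : expR (- (2 * B / l)) <= r w.
  have /andP[_] := mgf_bound P1 mX XB l^-1; rewrite (ger0_norm lV0) -/M => hM.
  rewrite /r ler_pdivlMr//; apply: le_trans (ler_wpM2l (expR_ge0 _) hM) _.
  rewrite -expRD ler_expR.
  have : - (l^-1 * B) <= l^-1 * X w.
    by rewrite -mulrN ler_wpM2l// lerNl (le_trans (ler_norm _))// normrN.
  have -> : 2 * B / l = 2 * (l^-1 * B) by field; rewrite lt0r_neq0.
  lra.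
have := expR_ge1Dx (- (2 * B / l)); have := expR_ge1Dx (2 * B / l).
rewrite /c; lra.
Qed.

Let integrable_r : P.-integrable setT (EFin \o r).
Proof.
apply: (@finite_measure_bounded_integrable _ _ _ _ _ (1 + c)) => // w.
by have /andP[r0 r1] := r_bound w; rewrite ger0_norm.
Qed.

Let Er : \int[P]_w r w = 1.
Proof.
rewrite /r RintegralZr//; last exact: integrable_mgf mX XB _.
by rewrite -/(mgf _ _ _) -/M divff// lt0r_neq0.
Qed.

Let Er1 : \int[P]_w (r w - 1) = 0.
Proof.
have i1 : P.-integrable setT (EFin \o cst (1 : R)).
  exact: finite_measure_integrable_cst.
by rewrite (RintegralB measurableT integrable_r i1) Er (Rintegral_cst1 P1) subrr.
Qed.

(* For [B <= l] use [(r - 1)^2 <= c^2] and [c = O(B / l)]; otherwise use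
   [r^2 <= (1 + c) r] and [l >= eps / (2 tau)]. *)
Let Er2_ct : \int[P]_w ((r w - 1) ^+ 2) <= V /\ c * t <= 2 * V.
Proof.
have mr2 : measurable_fun setT (fun w => (r w - 1) ^+ 2).
  by apply: measurable_funX; exact: measurable_funB.
have i2 : P.-integrable setT (EFin \o (fun w => (r w - 1) ^+ 2)).
  apply: (@finite_measure_bounded_integrable _ _ _ _ _ (c ^+ 2)) => // w.
  by rewrite normrX lerXn2r ?nnegrE.
have E1 : 1 <= expR (4 * tau * B / eps).
  by rewrite -expR0 ler_expR divr_ge0 ?mulr_ge0// ltW.
have [Bl|lB] := leP B l.
  have tE : t = eps / (4 * l).
    rewrite /t min_l /eta; first by field; rewrite lt0r_neq0.
    rewrite ler_pdivrMr ?mulr_gt0// mul1r (le_trans epsB)// (le_trans Bl)//.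
    by rewrite ler_peMl ?ler1n// ltW.
  have cB : c <= 32 * (B / l).
    have -> : 32 * (B / l) = 16 * (2 * B / l) by field; rewrite lt0r_neq0.
    apply: expR_sub1_le; first by rewrite divr_ge0 ?mulr_ge0// ltW.
    by rewrite ler_pdivrMr//; lra.
  have VB : (32 * (B / l)) ^+ 2 <= V.
    rewrite /V tE /h.
    have -> : (128 * (eps / (4 * l))) ^+ 2 * (B ^+ 2 * expR (4 * tau * B / eps) / eps ^+ 2)
      = (32 * (B / l)) ^+ 2 * expR (4 * tau * B / eps).
      by field; rewrite !lt0r_neq0.
    by apply: ler_peMr => //; exact: sqr_ge0.
  have Bl0 : 0 <= B / l by rewrite divr_ge0// ltW.
  split.
    have /andP[_ h2] : 0 <= \int[P]_w ((r w - 1) ^+ 2) <= c ^+ 2.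
      apply: (Rintegral_bound P1) => // w; rewrite sqr_ge0/=.
      by rewrite -[leLHS]real_normK ?num_real// lerXn2r ?nnegrE.
    apply: le_trans h2 _; apply: le_trans VB.
    rewrite lerXn2r ?nnegrE//; apply: mulr_ge0 => //.
  have : t <= B / l.
    rewrite tE ler_pdivrMr ?mulr_gt0//.
    have -> : B / l * (4 * l) = 4 * B by field; rewrite lt0r_neq0.
    move: epsB B0; lra.
  move=> tB; have := ler_pM c0 (ltW t0) cB tB.
  have := sqr_ge0 (B / l); move: VB; rewrite exprMn expr2; lra.
(* The least grid point fixes the exponential: [l >= eps / (2 tau)] gives
   [2 B / l <= 4 tau B / eps]. *)
have cE : 1 + c <= expR (4 * tau * B / eps).
  rewrite /c addrC subrK ler_expR ler_pdivrMr//.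
  have -> : 4 * tau * B / eps * l = 2 * B * (l * (2 * tau) / eps).
    by field; rewrite lt0r_neq0.
  rewrite ler_peMr ?mulr_ge0 ?(ltW B0)// ler_pdivlMr// mul1r.
  by move: l0; rewrite ler_pdivrMr// mulr_gt0.
have tB : eps / (4 * B) <= t.
  rewrite /t ler_pdivlMr// [leLHS](_ : _ = eps / (2 * B)); last first.
    by field; rewrite lt0r_neq0.
  rewrite le_min; apply/andP; split.
    by rewrite /eta ler_pM2l// lef_pV2 ?posrE ?mulr_gt0// ler_pM2l// ltW.
  by rewrite ler_pdivrMr ?mulr_gt0// mul1r; move: epsB B0; lra.
have VE : 32 ^+ 2 * expR (4 * tau * B / eps) <= V.
  have -> : 32 ^+ 2 * expR (4 * tau * B / eps) = (128 * (eps / (4 * B))) ^+ 2 * h.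
    by rewrite /h; field; rewrite !lt0r_neq0.
  have q0 : 0 <= eps / (4 * B) by apply: ltW; rewrite divr_gt0// mulr_gt0.
  rewrite /V; apply: ler_wpM2r; first exact: ltW.
  rewrite lerXn2r ?nnegrE//; last by rewrite ler_pM2l.
    by apply: mulr_ge0.
  by apply: mulr_ge0 => //; exact: ltW.
split.
  have ic : P.-integrable setT (EFin \o cst (1 : R)).
    exact: finite_measure_integrable_cst.
  have ir : P.-integrable setT (EFin \o (fun w => (c - 1) * r w)).
    by have := integrableZl measurableT (c - 1) integrable_r; apply: eq_integrable.
  (* As [r] has mean 1, this majorant has mean [c]: linear, not quadratic, in the range. *)
  apply: (@le_trans _ _ (\int[P]_w ((c - 1) * r w + cst 1 w))).
    apply: le_Rintegral => //; first exact: (integrableD measurableT ir ic).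
    move=> w _ /=; have /andP[r0 r1] := r_bound w.
    have : 0 <= r w * (1 + c - r w) by rewrite mulr_ge0// subr_ge0.
    rewrite expr2; lra.
  rewrite (RintegralD measurableT ir ic) (RintegralZl _ measurableT integrable_r).
  by rewrite Er (Rintegral_cst1 P1); move: cE VE E1; lra.
have t1 : t <= 1 by rewrite /t ler_pdivrMr// ge_min; apply/orP; right; lra.
have : c * t <= c by rewrite ler_piMr.
move: cE VE E1; lra.
Qed.

(** [theta = t / (4 V)] maximizes [theta t - 2 theta^2 V], with value [t^2 / (8 V)]; the condition
    [c * t <= 2 * V] says that this [theta] is admissible. *)
Let tail (Y : T -> R) : measurable_fun setT Y -> (forall w, `|Y w| <= c) ->
  \int[P]_w Y w = 0 -> \int[P]_w (Y w ^+ 2) <= V ->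
  measurable [set s | (n%:R * t <= \sum_(i < n) Y (x i s))%R] /\
  (mu [set s | (n%:R * t <= \sum_(i < n) Y (x i s))%R] <=
    (expR (- (n%:R / (8 * 128 ^+ 2 * h))))%:E)%E.
Proof.
move=> mY Yc EY EY2; have [_ ct] := Er2_ct.
have th0 : 0 <= t / (4 * V).
  by apply: divr_ge0; [exact: ltW|apply: mulr_ge0 => //; exact: ltW].
have [|mA muA] := @Chernoff_iid _ _ _ _ _ _ _ _ _ _ c V t (t / (4 * V)) iidx mY Yc EY EY2 th0.
  have V4 : 0 < 4 * V by apply: mulr_gt0.
  by rewrite mulrC mulrA ler_pdivrMr//; move: ct; lra.
split => //; rewrite (le_trans muA)// lee_fin ler_expR lerN2.
rewrite le_eqVlt; apply/orP; left; apply/eqP.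
by rewrite /V; field; rewrite !lt0r_neq0.
Qed.

(** The two values of [logmgf] differ by [l ln rho] up to sign, with [rho] the empirical mean of
    [r]; [U] joins the upper and lower tail events of [rho]. *)
Lemma logmgf_deviation : exists U : set S, [/\ measurable U,
  (mu U <= (2 * expR (- (n%:R / (8 * 128 ^+ 2 * h))))%:E)%E &
  forall s, ~ U s -> `|logmgf P X l - logmgf (emp s) X l| <= eps / 2].
Proof.
have [EV _] := Er2_ct.
have mr1 : measurable_fun setT (fun w => r w - 1) by exact: measurable_funB.
have mr1' : measurable_fun setT (fun w => 1 - r w) by exact: measurable_funB.
have [mU1 muU1] := tail mr1 r_dev Er1 EV.
have [|||mU2 muU2] := tail mr1'.
- by move=> w; rewrite distrC; exact: r_dev.
- have i1 : P.-integrable setT (EFin \o cst (1 : R)).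
    exact: finite_measure_integrable_cst.
  by rewrite (RintegralB measurableT i1 integrable_r) Er (Rintegral_cst1 P1) subrr.
- by under eq_Rintegral do rewrite -sqrrN opprB.
exists ([set s | (n%:R * t <= \sum_(i < n) (r (x i s) - 1))%R] `|`
  [set s | (n%:R * t <= \sum_(i < n) (1 - r (x i s)))%R]).
split; first exact: measurableU.
  apply: le_trans (measureU2 _ _ _) _ => //.
  set e := expR _ in muU1 muU2 *; have -> : 2 * e = e + e by ring.
  by rewrite EFinD; exact: leeD.
move=> s /not_orP[/negP + /negP]; rewrite -!ltNge !sumrB sumr_const card_ord.
have nR : 0 < n%:R :> R by rewrite ltr0n.
pose rho := n%:R^-1 * \sum_(i < n) r (x i s).
have -> : \sum_(i < n) r (x i s) = n%:R * rho by rewrite mulVKf// lt0r_neq0.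
have -> : n%:R * rho - 1 *+ n = n%:R * (rho - 1) by ring.
have -> : 1 *+ n - n%:R * rho = n%:R * (1 - rho) by ring.
rewrite !ltr_pM2l// => rho1 rho2.
have rho_gt0 : 0 < rho.
  have : t <= 1 by rewrite /t ler_pdivrMr// ge_min; apply/orP; right; lra.
  lra.
have mgfE' : mgf (emp s) X l^-1 = rho * M.
  rewrite mgf_empirical// /rho /r -mulr_suml mulrA divfK// lt0r_neq0//.
rewrite /logmgf mgfE' -/M lnM ?posrE// -mulrBr opprD addrCA subrr addr0.
rewrite normrM normrN (gtr0_norm l_gt0).
have -> : eps / 2 = l * eta by rewrite /eta; field; rewrite lt0r_neq0.
rewrite ler_pM2l// ler_norml.
have te : t <= eta / 2 by rewrite ler_pM2r// ge_min lexx.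
have t2 : t <= 1 / 2 by rewrite ler_pM2r// ge_min lexx orbT.
apply/andP; split; last first.
  rewrite -[leRHS]expRK ler_ln ?posrE ?expR_gt0//.
  by apply: le_trans (expR_ge1Dx _); move: eta0; lra.
(* Lower side: [expR (- eta) <= 1 / (1 + eta) <= 1 - t < rho]. *)
rewrite -[leLHS]expRK ler_ln ?posrE ?expR_gt0//.
apply: (@le_trans _ _ (1 - t)); last by lra.
have : expR (- eta) * (1 + eta) <= expR (- eta) * expR eta.
  by rewrite ler_pM2l ?expR_gt0// expR_ge1Dx.
rewrite mulrC [leRHS]mulrC expRxMexpNx_1 => h1.
have e1 : 0 < 1 + eta by rewrite addr_gt0.
rewrite -(ler_pM2l e1); apply: le_trans h1 _.
have : t * eta <= 1 / 2 * eta by rewrite ler_pM2r.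
by move: te; lra.
Qed.

End fixed_multiplier.

Lemma measurable_worst_case_empirical :
  measurable_fun setT (fun s => fine (worst_case (emp s) tau X)).
Proof.
have E1 s : emp s setT = 1%E by exact: empirical_setT.
apply: (measurability _ (RGenInftyO.measurableE R)) => // _ [_ [a ->] <-].
rewrite setTI.
have -> : (fun s => fine (worst_case (emp s) tau X)) @^-1` `]-oo, a[ =
    \bigcup_(q : rat) [set s | 0 < ratr q :> R /\
      ratr q * tau + logmgf (emp s) X (ratr q) < a].
  apply/seteqP; split=> s /=; rewrite in_itv/=.
    by move=> /(fine_worst_case_lt (E1 s) mX XB tau0)[q hq]; exists q.
  by move=> [q _ hq]; apply/(fine_worst_case_lt (E1 s) mX XB tau0); exists q.
apply: bigcupT_measurable_rat => q.
have [q0|q0] := ltP 0 (ratr q : R); last first.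
  rewrite [X in measurable X](_ : _ = set0)//.
  by apply/seteqP; split=> s //= -[].
pose F s := ratr q * tau + logmgf (emp s) X (ratr q).
rewrite [X in measurable X](_ : _ = setT `&` F @^-1` `]-oo, a[); last first.
  by rewrite setTI; apply/seteqP; split=> s /=; rewrite in_itv/=; [case|].
suff mF : measurable_fun setT F by apply: mF => //; exact: measurable_itv.
apply: measurable_funD => //; apply: measurable_funM => //.
apply: measurableT_comp => //.
under eq_fun do rewrite mgf_empirical//.
apply: measurable_funM => //; apply: measurable_sum => i.
apply: measurableT_comp => //; apply: measurable_funM => //.
exact: measurableT_comp.
Qed.

End deviation.

(** * From grid points to worst cases *)

Section dual_stability.
Context d (T : measurableType d) (R : realType).
Context (P P' : {finite_measure set T -> \bar R}).
Context (P1 : P setT = 1%E) (P'1 : P' setT = 1%E).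
Context (X : T -> R) (mX : measurable_fun setT X).
Context (B eps tau : R) (XB : forall w, `|X w| <= B).
Context (eps0 : 0 < eps) (tau0 : 0 < tau).

(** A nearly optimal multiplier for [P'] is moved to the grid at cost [eps / 2], and changing the
    measure there costs another [eps / 2]. Being one-sided, the bound is applied in both
    directions. *)
Lemma worst_case_le_grid (K : nat) : 4 * B / eps <= K%:R -> (0 < K)%N ->
  (forall k, (k < K)%N -> let l := k.+1%:R * (eps / (2 * tau)) in
    logmgf P X l - logmgf P' X l <= eps / 2) ->
  fine (worst_case P tau X) - fine (worst_case P' tau X) <= eps.
Proof.
move=> KB K0 dev; apply/ler_addgt0Pr => e e0.
have [l l0 hl] := le_fine_worst_case P'1 mX XB tau0 e0.
have [k kK hk] := dual_grid P'1 mX XB tau0 eps0 KB K0 l0.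
have lk0 : 0 < k.+1%:R * (eps / (2 * tau)).
  by rewrite mulr_gt0// divr_gt0// mulr_gt0.
have := fine_worst_case_le P1 mX XB tau0 lk0.
move: (dev _ kK) hk hl; cbv zeta; lra.
Qed.

End dual_stability.

Unset Implicit Arguments.

(* The constant is [6 * (8 * 128 ^ 2)]: the deviation exponent is
   [n / (8 * 128 ^ 2 * h)], and [A ^ 6] absorbs [1 / delta] and the number
   [O(h)] of grid points. *)
Theorem corollary4p7 (R : realType) :
  exists C : R, 0 < C /\
  forall (tau B : R), 0 < tau -> 0 < B ->
  forall (d : measure_display) (T : measurableType d) (P : probability T R)
    (X : {mfun T >-> R}), (forall w, - B <= X w <= B) ->
  forall (delta eps : R), 0 < delta < 1 -> 0 < eps <= B ->
  let h := B ^+ 2 * expR (4 * tau * B / eps) / eps ^+ 2 in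
  let Lambda := ln (expR 1 + h + B + B^-1 + eps^-1 + tau + tau^-1 + delta^-1) in
  forall (n : nat), C * Lambda `^ C * h <= n%:R ->
  forall (d' : measure_display) (S : measurableType d') (mu : probability S R)
    (x : 'I_n -> {mfun S >-> T}), iid_sample mu P x ->
  let good := [set s : S |
    (`| worst_case P tau X
        - worst_case (empirical R (fun i => x i s)) tau X | <= eps%:E)%E] in
  measurable good /\ ((1 - delta)%:E <= mu good)%E.
Proof.
exists (48 * 128 ^+ 2); split; first by rewrite mulr_gt0// exprn_gt0.
move=> tau B tau0 B0 d T P X XB0 delta eps /andP[delta0 _] /andP[eps0 epsB].
set C : R := 48 * 128 ^+ 2.
have C1 : 1 <= C.
  by rewrite /C -[leLHS]mulr1 ler_pM// ?ler1n// exprn_ege1// ler1n.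
move=> h Lambda n hn d' S mu x iidx good.
have XB w : `|X w| <= B by rewrite ler_norml XB0.
have mX : measurable_fun setT X by exact: measurable_funPT.
have P1 : P setT = 1%E by exact: probability_setT.
have h0 : 0 < h by rewrite divr_gt0 ?exprn_gt0// mulr_gt0 ?exprn_gt0 ?expR_gt0.
(* Since [B / eps] is at least 1, [h] dominates it, and with it the number of grid points. *)
have hB : B / eps <= h.
  have Be1 : 1 <= B / eps by rewrite ler_pdivlMr// mul1r.
  have Be0 : 0 <= B / eps by rewrite divr_ge0// ltW.
  have -> : h = (B / eps) * ((B / eps) * expR (4 * tau * B / eps)).
    by rewrite /h; field; rewrite lt0r_neq0.
  rewrite ler_peMr// mulr_ege1// -expR0 ler_expR.
  by rewrite divr_ge0 ?mulr_ge0// ltW.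
move: @Lambda hn; set A := (X in ln X) => Lambda hn.
have [A2 Ah Adelta Ae] : [/\ 2 <= A, h <= A, delta^-1 <= A & expR 1 <= A].
  have e2 : 2 <= expR 1 :> R by have := expR_ge1Dx (1 : R); lra.
  have : 0 < B^-1 by rewrite invr_gt0.
  have : 0 < eps^-1 by rewrite invr_gt0.
  have : 0 < tau^-1 by rewrite invr_gt0.
  have : 0 < delta^-1 by rewrite invr_gt0.
  by rewrite /A; split; lra.
have A0 : 0 < A by apply: lt_le_trans A2.
have La1 : 1 <= Lambda.
  by rewrite /Lambda -[leLHS]expRK ler_ln ?posrE ?expR_gt0.
(* [Lambda] and [C] are at least 1, so the power of [Lambda] dominates [Lambda] itself. *)
have {}hn : C * Lambda * h <= n%:R.
  apply: le_trans hn; rewrite ler_pM2r// ler_pM2l; last exact: lt_le_trans C1.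
  exact: le1r_powR.
have n0 : (0 < n)%N.
  rewrite -(ltr0n R); apply: lt_le_trans hn.
  by rewrite mulr_gt0// mulr_gt0//; [apply: lt_le_trans C1|apply: lt_le_trans La1].
pose K := (Num.truncn (4 * B / eps)).+1.
have KB : 4 * B / eps <= K%:R by rewrite ltW// truncnS_gt.
have K5 : K%:R <= 5 * h.
  have : (Num.truncn (4 * B / eps))%:R <= 4 * B / eps.
    by rewrite truncn_le divr_ge0// ?mulr_ge0// ltW.
  rewrite /K -natr1; have : 1 <= B / eps by rewrite ler_pdivlMr// mul1r.
  by rewrite -mulrA; lra.
pose l k : R := k.+1%:R * (eps / (2 * tau)).
have l0 k : eps / (2 * tau) <= l k.
  by rewrite /l ler_peMl ?ler1n// divr_ge0 ?mulr_ge0// ltW.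
have /choice[U dev] := fun k =>
  logmgf_deviation iidx n0 mX XB eps0 epsB tau0 (l0 k).
pose bad := \big[setU/set0]_(k < K) U k.
have mU k : measurable (U k) by have [] := dev k.
have mbad : measurable bad by exact: bigsetU_measurable.
have bad_le : (mu bad <= delta%:E)%E.
  apply: le_trans (Boole_inequality _ (fun k _ => mU k)) _.
  apply: (@le_trans _ _
      (\sum_(k < K) (2 * expR (- (n%:R / (8 * 128 ^+ 2 * h))))%:E)%E).
    by apply: lee_sum => k _; have [] := dev k.
  rewrite sumEFin sumr_const card_ord lee_fin -[leLHS]mulr_natl.
  have A6 : expR (- (n%:R / (8 * 128 ^+ 2 * h))) <= (A ^+ 6)^-1.
    have -> : A ^+ 6 = expR (6 * Lambda) by rewrite expRM_natl lnK.
    have D0 : 0 < 8 * 128 ^+ 2 * h.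
      by apply: mulr_gt0 => //; rewrite mulr_gt0// exprn_gt0.
    rewrite -expRN ler_expR lerN2 ler_pdivlMr//.
    apply: le_trans hn; rewrite le_eqVlt; apply/orP; left; apply/eqP.
    by rewrite /C; ring.
  (* Here 10 is 5 from the grid size times 2 from the two tails. One factor [A] pays for [h], one
     for [delta^-1], and [A ^+ 4 >= 16] for the 10. *)
  have hA : 10 * h <= delta * A ^+ 6.
    have -> : delta * A ^+ 6 = A ^+ 4 * (A * (delta * A)) by ring.
    have dA : 1 <= delta * A by rewrite mulrC -ler_pdivrMr// mul1r.
    have hAd : h <= A * (delta * A).
      by apply: le_trans Ah _; rewrite ler_peMr// ltW.
    apply: ler_pM => //; [exact: ltW|].
    have : 2 ^+ 4 <= A ^+ 4 by rewrite lerXn2r ?nnegrE// ltW.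
    by apply: le_trans; rewrite -natrX ler_nat.
  apply: (@le_trans _ _ (5 * h * (2 * (A ^+ 6)^-1))).
    by rewrite ler_pM// ?mulr_ge0 ?expR_ge0// ler_pM2l.
  have -> : 5 * h * (2 * (A ^+ 6)^-1) = 10 * h / A ^+ 6 by ring.
  by rewrite ler_pdivrMr// exprn_gt0.
pose r s := fine (worst_case (empirical R (fun i => x i s)) tau X).
have E1 s : empirical R (fun i => x i s) setT = 1%E by exact: empirical_setT.
have goodE s : good s <-> `|fine (worst_case P tau X) - r s| <= eps.
  rewrite /good/= -(fineK (worst_case_fin_num P1 mX XB tau0)).
  by rewrite -(fineK (worst_case_fin_num (E1 s) mX XB tau0)) -EFinB abse_EFin lee_fin.
have mgood : measurable good.
  rewrite [good](_ : _ = setT `&` [set s |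
      `|fine (worst_case P tau X) - r s| <= eps]); last first.
    by rewrite setTI; apply/seteqP; split=> s /goodE.
  apply: measurable_fun_le => //; apply: measurableT_comp => //.
  apply: measurable_funB => //.
  exact (measurable_worst_case_empirical x n0 mX XB tau0).
split => //; have bad_good : ~` bad `<=` good.
  move=> s nbad; apply/goodE.
  have h1 k : (k < K)%N -> `|logmgf P X (l k) -
      logmgf (empirical R (fun i => x i s)) X (l k)| <= eps / 2.
    move=> kK; have [_ _] := dev k; apply => Uks; apply: nbad.
    by rewrite /bad -bigcup_mkord; exists k.
  rewrite ler_norml lerNl opprB; apply/andP; split.
    apply: (worst_case_le_grid (E1 s) P1 mX XB eps0 tau0 KB) => // k kK.
    by apply: le_trans (ler_norm _) _; rewrite distrC; exact: h1.
  apply: (worst_case_le_grid P1 (E1 s) mX XB eps0 tau0 KB) => // k kK.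
  by apply: le_trans (ler_norm _) _; exact: h1.
apply: (@le_trans _ _ (mu (~` bad))); last first.
  by apply: le_measure; rewrite ?inE//; exact: measurableC.
rewrite probability_setC// EFinB; exact: leeB.
Qed.
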